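(* The permutation statistics $\operatorname{des}$ (descent number) and $(\operatorname{maj},\operatorname{des})$ (the pair consisting of the major index and the descent number) are shuffle compatible.
   Context: For a finite set $U$ of positive integers, a permutation of $U$ is a linear order $\pi=\pi_1\pi_2\cdots\pi_m$ of all the elements of $U$ (each appearing exactly once); write $\operatorname{dom}(\pi)=U$, $|\pi|=|U|=m$, and let $L(U)$ be the set of permutations of $U$. Two permutations $\pi\in L(U)$, $\pi'\in L(V)$ with $|U|=|V|$ have the same relative order if applying the unique strictly increasing bijection $U\to V$ to the entries of $\pi$ gives $\pi'$. A permutation statistic is a map $\operatorname{St}$ defined on all permutations of all finite sets of positive integers such that $\operatorname{St}(\pi)=\operatorname{St}(\pi')$ whenever $\pi$ and $\pi'$ have the same relative order. For permutations $\pi,\sigma$ with disjoint domains, the shuffle set $\operatorname{Sh}(\pi,\sigma)$ is the set of all $\tau\in L(\operatorname{dom}(\pi)\sqcup\operatorname{dom}(\sigma))$ containing both $\pi$ and $\sigma$ as (not necessarily contiguous) subwords. For a set $\Pi$ of permutations, $\operatorname{St}(\Pi)$ denotes the multiset $\{\{\operatorname{St}(\pi) : \pi\in\Pi\}\}$. A permutation statistic $\operatorname{St}$ is shuffle compatible if for all permutations $\pi,\pi',\sigma,\sigma'$ with $|\pi|=|\pi'|$, $|\sigma|=|\sigma'|$, $\operatorname{dom}(\pi)\cap\operatorname{dom}(\sigma)=\operatorname{dom}(\pi')\cap\operatorname{dom}(\sigma')=\emptyset$, $\operatorname{St}(\pi)=\operatorname{St}(\pi')$ and $\operatorname{St}(\sigma)=\operatorname{St}(\sigma')$,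 one has the equality of multisets $\operatorname{St}(\operatorname{Sh}(\pi,\sigma))=\operatorname{St}(\operatorname{Sh}(\pi',\sigma'))$. For $\pi=\pi_1\cdots\pi_m$: $\operatorname{Des}(\pi)=\{i\in[m-1] : \pi_i>\pi_{i+1}\}$, $\operatorname{des}(\pi)=|\operatorname{Des}(\pi)|$, and $\operatorname{maj}(\pi)=\sum_{i\in\operatorname{Des}(\pi)} i$. *)

(* Defs.v *)
From mathcomp Require Import all_boot.

Set Implicit Arguments.
Unset Strict Implicit.
Unset Printing Implicit Defensive.

(* A permutation of a finite set U of positive integers is the duplicate-free
   word listing U; U itself is recovered as the set of letters of the word. *)
Definition is_permutation (p : seq nat) : bool := uniq p && all (leq 1) p.

(* A strictly increasing f on the letters of p with map f p = q is
   automatically a bijection from dom(p) to dom(q). *)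
Definition same_relative_order (p q : seq nat) : Prop :=
  exists2 f : nat -> nat, {in p &, {homo f : x y / x < y}} & map f p = q.

(* The values of a statistic on words that are not permutations are
   irrelevant: they are unconstrained here and never used below. *)
Record perm_stat (T : Type) := PermStat {
  stat_fun :> seq nat -> T;
  stat_relative_order : forall p q : seq nat,
    is_permutation p -> is_permutation q ->
    same_relative_order p q -> stat_fun p = stat_fun q
}.

(* [permutations] enumerates without repetition, so for disjoint p and s this
   lists each element of the shuffle set exactly once. *)
Definition shuffles (p s : seq nat) : seq (seq nat) :=
  [seq t <- permutations (p ++ s) | subseq p t & subseq s t].

Definition disjoint_dom (p s : seq nat) : Prop := {in p, forall x, x \notin s}.

Definition shuffle_compatible (T : eqType) (St : perm_stat T) : Prop :=
  forall p p' s s' : seq nat,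
    is_permutation p -> is_permutation p' ->
    is_permutation s -> is_permutation s' ->
    size p = size p' -> size s = size s' ->
    disjoint_dom p s -> disjoint_dom p' s' ->
    St p = St p' -> St s = St s' ->
    perm_eq [seq St t | t <- shuffles p s] [seq St t | t <- shuffles p' s'].

(* Positions are counted from 1: the i-th letter of p is nth 0 p i.-1. *)
Definition Des (p : seq nat) : seq nat :=
  [seq i <- iota 1 (size p).-1 | nth 0 p i < nth 0 p i.-1].

Definition des_fun (p : seq nat) : nat := size (Des p).

Definition maj_fun (p : seq nat) : nat := \sum_(i <- Des p) i.

Lemma Des_relative_order (p q : seq nat) :
  same_relative_order p q -> Des p = Des q.
Proof.
case=> f f_mono <-; rewrite /Des size_map; apply: eq_in_filter => i.
rewrite mem_iota => /andP[i_gt0 i_lt].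
have ip : i < size p by move: i_lt; rewrite add1n; case: (size p) => //; case: i i_gt0.
have ip' : i.-1 < size p by apply: leq_ltn_trans (leq_pred i) ip.
rewrite !(nth_map 0) //.
by rewrite (leqW_mono_in (leq_mono_in f_mono)) ?mem_nth.
Qed.

Lemma des_relative_order (p q : seq nat) :
  is_permutation p -> is_permutation q ->
  same_relative_order p q -> des_fun p = des_fun q.
Proof. by move=> _ _ pq; rewrite /des_fun (Des_relative_order pq). Qed.

Lemma maj_des_relative_order (p q : seq nat) :
  is_permutation p -> is_permutation q -> same_relative_order p q ->
  (maj_fun p, des_fun p) = (maj_fun q, des_fun q).
Proof. by move=> _ _ pq; rewrite /maj_fun /des_fun (Des_relative_order pq). Qed.

Definition des : perm_stat nat := PermStat des_relative_order.

Definition maj_des : perm_stat (nat * nat) :=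
  @PermStat _ (fun p => (maj_fun p, des_fun p)) maj_des_relative_order.

(* Main.v *)
Require Import Defs.
From mathcomp Require Import all_boot zify.

Set Implicit Arguments.
Unset Strict Implicit.
Unset Printing Implicit Defensive.

(** This is Stanley's P-partition argument, done with sorting.  Attach to each
    letter of a permutation [p] a value below a bound [M], so that the values
    decrease weakly along [p], and strictly across each descent of [p]: this is
    a labeling of [p], and its weight is the sum of its values.  Two facts
    about labelings give shuffle compatibility.

    Labelings turn shuffles into products ([labelings_shuffles]).  If distinct
    letters receive arbitrary values, exactly one word on these letters is
    labeled by them, namely the letters sorted by decreasing value, ties being
    broken by increasing letter.  Hence a labeling of some shuffle of [p] and
    [s] is the same as a pair of a labeling of [p] and a labeling of [s].

    The distribution of weights knows [maj] and [des], and nothing more.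
    Subtracting from each value the number of descents at or after its position
    removes the strictness conditions; it lowers the weight by [maj p] and the
    bound by [des p].  So the weights for the bound [M] are [maj p] plus the
    weights of the weakly decreasing sequences below [M - des p]
    ([weight_labelings_cons]).  This is triangular in [des]: at [M = d + 1]
    the words with more than [d] descents contribute nothing and those with
    exactly [d] contribute their [maj] once, so the multiset of pairs
    [(maj, des)] of a family of words of equal length is recovered from its
    weights for all bounds ([label_weights_inj]).

    Scaling every weight by a constant [c] treats both statistics at once:
    [c = 1] keeps [maj], and [c = 0] forgets it, leaving [des] alone. *)

(** * Labelings of words *)

(** Pairs are (value, letter).  Adding the boolean to the strict bound says
    that the value decreases weakly, and strictly if the letter drops: the
    lexicographic order by decreasing value, then increasing letter. *)
Definition outranks : rel (nat * nat) := fun e e' => e'.1 < e.1 + (e.2 <= e'.2).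

(** The bound handed to the tail is what [outranks] allows after [(a, x)].  For
    the last letter [head x p'] is [x], but the empty tail ignores its bound. *)
Fixpoint labelings (p : seq nat) (M : nat) : seq (seq (nat * nat)) :=
  if p is x :: p' then
    [seq (a, x) :: z | a <- iota 0 M, z <- labelings p' (a + (x <= head x p'))]
  else [:: [::]].

Definition weight (z : seq (nat * nat)) : nat := sumn (unzip1 z).

Lemma outranks_trans : transitive outranks.
Proof. move=> [a x] [b y] [c z]; rewrite /outranks /=; lia. Qed.

Lemma outranks_total : total outranks.
Proof. move=> [a x] [b y]; rewrite /outranks /=; lia. Qed.

Lemma outranks_anti : antisymmetric outranks.
Proof.
move=> [a x] [b y]; rewrite /outranks /= => h.
by have [-> ->] : a = b /\ x = y by lia.
Qed.

(** The recursion bounds each value by its predecessor only; since [outranks] is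
    transitive this amounts to a sorted word with all values below [M]. *)
Lemma mem_labelings p M z :
  (z \in labelings p M) =
  [&& unzip2 z == p, sorted outranks z & all (fun e => e.1 < M) z].
Proof.
elim: p M z => [|x p IHp] M [|[a y] z] //=.
  by apply/negP => /allpairsPdep[? [? []]].
rewrite eqseq_cons; apply/allpairsPdep/idP => [[b [t [bM tp [-> -> ->]]]]|].
  move: bM tp; rewrite mem_iota IHp eqxx /= add0n => bM /and3P[/eqP tp tsort tlt].
  rewrite tp eqxx bM /= andbC; apply/andP; split.
    by apply: sub_all tlt => e; lia.
  by case: t tp tsort tlt => [|[c w] t] //= <- /= -> /andP[cb _]; rewrite /outranks /= cb.
case/and3P=> /andP[/eqP-> /eqP zp] zpath /andP[aM _].
exists a, z; split=> //; first by rewrite mem_iota.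
rewrite IHp zp eqxx (path_sorted zpath) /=.
case: z zp zpath => [|[c w] z] //= <- /= /andP[aw zpath].
rewrite {1}/outranks /= in aw; rewrite aw /=.
have := order_path_min outranks_trans zpath.
by apply: sub_all => e; rewrite /outranks /=; lia.
Qed.

Lemma labelings_uniq p M : uniq (labelings p M).
Proof.
elim: p M => //= x p IHp M; apply: allpairs_uniq_dep => //.
- exact: iota_uniq.
- by move=> [a z] [b t] _ _ /= [-> ->].
Qed.

Lemma mem_shuffles p s t :
  uniq (p ++ s) ->
  (t \in shuffles p s) =
  [&& perm_eq t (p ++ s), p == [seq x <- t | x \in p]
    & s == [seq x <- t | x \in s]].
Proof.
move=> ups; rewrite mem_filter mem_permutations andbC.
case: (boolP (perm_eq t _)) => //= tps.
have ut : uniq t by rewrite (perm_uniq tps).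
by congr (_ && _); apply/(subseq_uniqP ut)/eqP.
Qed.

(** * Labelings of shuffles *)

(** Sorting the union of two labelings is inverted by restricting a labeling of
    the shuffle to the letters of [p] and to those of [s]: restriction commutes
    with sorting, and a sorted word is determined by its multiset of pairs. *)
Lemma labelings_shuffles p s M :
  uniq (p ++ s) ->
  perm_eq (flatten [seq labelings t M | t <- shuffles p s])
          [seq sort outranks (z ++ z') | z <- labelings p M, z' <- labelings s M].
Proof.
move=> ups.
have ps x : x \in p -> x \in s = false.
  move: ups; rewrite cat_uniq => /and3P[_ /hasPn/(_ x) h _] xp.
  by apply/negP => /h/negP.
have letters (z : seq (nat * nat)) (u : seq nat) :
    unzip2 [seq e <- z | e.2 \in u] = [seq x <- unzip2 z | x \in u].
  by rewrite /unzip2 filter_map.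
have restr (z z' : seq (nat * nat)) : unzip2 z = p -> unzip2 z' = s ->
    [seq e <- z ++ z' | e.2 \in p] = z /\ [seq e <- z ++ z' | e.2 \in s] = z'.
  move=> zp zs; rewrite !filter_cat.
  have zP e : e \in z -> e.2 \in p by move=> ez; rewrite -zp map_f.
  have zS e : e \in z' -> e.2 \in s by move=> ez; rewrite -zs map_f.
  split; [rewrite -[RHS]cats0 | rewrite -[RHS]cat0s]; congr (_ ++ _).
  - exact/all_filterP/allP.
  - rewrite (eq_in_filter (a2 := pred0)) ?filter_pred0 // => e /zS es.
    by apply/negP => /ps; rewrite es.
  - by rewrite (eq_in_filter (a2 := pred0)) ?filter_pred0 // => e /zP/ps->.
  - exact/all_filterP/allP.
have restr_sort z z' : z \in labelings p M -> z' \in labelings s M ->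
    [seq e <- sort outranks (z ++ z') | e.2 \in p] = z
    /\ [seq e <- sort outranks (z ++ z') | e.2 \in s] = z'.
  rewrite !mem_labelings => /and3P[/eqP zp zs _] /and3P[/eqP z'p z's _].
  rewrite !(filter_sort outranks_total outranks_trans).
  have [-> ->] := restr _ _ zp z'p.
  by rewrite !(sorted_sort outranks_trans).
apply: uniq_perm.
- rewrite -[flatten _]map_id map_flatten -map_comp.
  apply: (allpairs_uniq_dep (f := fun _ z => z)) => [|t _|].
  + by rewrite filter_uniq ?permutations_uniq.
  + exact: labelings_uniq.
  (* A labeling determines the word that it labels. *)
  move=> [t z] [t' z'] /allpairsPdep[? [? [_ zt [-> ->]]]].
  move=> /allpairsPdep[? [? [_ zt' [-> ->]]]] /= zz'.
  move: zt zt'; rewrite zz' !mem_labelings.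
  by move=> /and3P[/eqP <- _ _] /and3P[/eqP <- _ _].
- apply: allpairs_uniq; rewrite ?labelings_uniq //.
  move=> [z z'] [u u'] /allpairsP[[? ?] [/= zp zs [-> ->]]].
  move=> /allpairsP[[? ?] [/= up us [-> ->]]] /= eqs.
  have := restr_sort _ _ zp zs; rewrite eqs => -[ez ez'].
  have [eu eu'] := restr_sort _ _ up us.
  by rewrite -ez -ez' eu eu'.
move=> z; apply/flatten_mapP/allpairsP => [[t]|[[u v] /= [up vs ->]]].
  rewrite mem_shuffles // mem_labelings => /and3P[tps /eqP tp /eqP ts].
  move=> /and3P[/eqP zt zsort zM].
  exists ([seq e <- z | e.2 \in p], [seq e <- z | e.2 \in s]) => /=.
  rewrite !mem_labelings !letters zt -tp -ts !eqxx /=.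
  rewrite !(sorted_filter outranks_trans) //=.
  rewrite !all_filter; split.
  + by apply: sub_all zM => e /= ->; rewrite implybT.
  + by apply: sub_all zM => e /= ->; rewrite implybT.
  apply: (sorted_eq outranks_trans outranks_anti) => //.
    exact: sort_sorted outranks_total _.
  rewrite perm_sym perm_sort.
  rewrite (eq_in_filter (a1 := fun e => e.2 \in s)
                        (a2 := predC (fun e => e.2 \in p))).
    by rewrite (perm_filterC (fun e : nat * nat => e.2 \in p)).
  move=> e ez /=; have : e.2 \in p ++ s by rewrite -(perm_mem tps) -zt map_f.
  by rewrite mem_cat; case: (boolP (e.2 \in p)) => [/ps->|].
have [fp fs] := restr_sort _ _ up vs.
move: up vs; rewrite !mem_labelings => /and3P[/eqP up _ uM] /and3P[/eqP vs _ vM].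
exists (unzip2 (sort outranks (u ++ v))).
  rewrite mem_shuffles // -!letters fp fs up vs !eqxx !andbT.
  by rewrite -up -vs /unzip2 -map_cat perm_map ?perm_sort.
rewrite mem_labelings eqxx sort_sorted ?all_sort ?all_cat ?uM //.
exact: outranks_total.
Qed.

(** * Weights of labelings *)

Lemma Des_cons2 x y p :
  Des [:: x, y & p] = nseq (y < x) 1 ++ [seq i.+1 | i <- Des (y :: p)].
Proof.
rewrite /Des /= -[2]/(1 + 1) iotaDl filter_map.
have -> : [seq i <- iota 1 (size p) | nth 0 (y :: p) i < nth 0 (y :: p) i.-1] =
  [seq i <- iota 1 (size p)
  | preim (addn 1) (fun i => nth 0 [:: x, y & p] i < nth 0 [:: x, y & p] i.-1) i].
  by apply: eq_in_filter => -[|i]; rewrite mem_iota.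
by case: (y < x).
Qed.

Lemma des_cons2 x y p : des_fun [:: x, y & p] = (y < x) + des_fun (y :: p).
Proof. by rewrite /des_fun Des_cons2 size_cat size_nseq size_map. Qed.

(** Putting a letter in front shifts every descent by one, and a new descent
    stands at position 1: [maj] grows by the new number of descents. *)
Lemma maj_cons2 x y p :
  maj_fun [:: x, y & p] = maj_fun (y :: p) + des_fun [:: x, y & p].
Proof.
rewrite des_cons2 /maj_fun /des_fun Des_cons2 big_cat big_map /=.
rewrite big_nseq iter_addn_0 mul1n.
under [X in _ + X]eq_bigr do rewrite -addn1.
by rewrite big_split /= sum1_size; lia.
Qed.

(** The scaled weights of the labelings of a word of length [n] with
    [(c * maj, des) = md]; labelings of a constant word are weakly decreasing
    sequences.  The test matters only for [n = 0], where truncated subtraction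
    would leave the empty sequence even beyond the bound. *)
Definition label_weights (c n : nat) (md : nat * nat) (M : nat) : seq nat :=
  if md.2 < M then [seq md.1 + c * weight z | z <- labelings (nseq n 0) (M - md.2)]
  else [::].

(** By induction on the word.  If the first value is [a] and the word has [d]
    descents, the tail contributes nothing for [a < d], and for [a = d + b] it
    contributes like the weakly decreasing sequences bounded by [b]; the excess
    [d] of the first value is the amount by which [maj] grows. *)
Lemma weight_labelings_cons c x p M :
  [seq c * weight z | z <- labelings (x :: p) M] =
  label_weights c (size p).+1 (c * maj_fun (x :: p), des_fun (x :: p)) M.
Proof.
elim: p x M => [|y p IHp] x M.
  rewrite /label_weights /= /maj_fun /des_fun /Des /= big_nil subn0.
  case: M => //= M; by rewrite muln0 !map_flatten -!map_comp.
have step a :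
    [seq c * weight z | z <- [seq (a, x) :: z
       | z <- labelings (y :: p) (a + (x <= y))]] =
    if des_fun [:: x, y & p] <= a then
      [seq c * maj_fun [:: x, y & p] + c * weight z | z <-
        [seq (a - des_fun [:: x, y & p], 0) :: z
          | z <- labelings (nseq (size p).+1 0) (a - des_fun [:: x, y & p]).+1]]
    else [::].
  rewrite -map_comp (eq_map (g := addn (c * a) \o (fun z => c * weight z))) => [|z /=]; last first.
    by rewrite -mulnDr.
  rewrite map_comp IHp.
  rewrite /label_weights ![(_, _).2]/= ![(_, _).1]/= maj_cons2 des_cons2.
  have -> : (des_fun (y :: p) < a + (x <= y)) = ((y < x) + des_fun (y :: p) <= a) by lia.
  case: ifP => // le_a; rewrite -!map_comp.
  have -> : a + (x <= y) - des_fun (y :: p) = (a - ((y < x) + des_fun (y :: p))).+1 by lia.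
  by apply: eq_map => z; rewrite /weight /=; nia.
rewrite [labelings _ _]/= map_flatten -map_comp (eq_map step).
rewrite /label_weights ![(_, _).2]/= ![(_, _).1]/=.
move: (des_fun _) (maj_fun _) => d m {step IHp}.
have drop k : k <= d -> forall g : nat -> seq nat,
    flatten [seq if d <= a then g a else [::] | a <- iota 0 k] = [::].
  move=> kd g; have: {in iota 0 k, (fun a => if d <= a then g a else [::]) =1 fun=> [::]}.
    by move=> a; rewrite mem_iota => ak; case: ifP => //; lia.
  by move/eq_in_map->; elim: (iota 0 k).
case: ltnP => [dM|/drop->//].
have -> : iota 0 M = iota 0 d ++ [seq d + b | b <- iota 0 (M - d)].
  by rewrite -iotaDl addn0 -iotaD subnKC // ltnW.
rewrite map_cat flatten_cat drop // cat0s [labelings _ _]/= map_flatten -!map_comp.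
congr flatten; apply: eq_map => b.
by rewrite /= -!map_comp leq_addr addKn (addn1 b).
Qed.

Lemma weight_labelings c p M :
  0 < M ->
  [seq c * weight z | z <- labelings p M] =
  label_weights c (size p) (c * maj_fun p, des_fun p) M.
Proof.
case: p => [|x p] M_gt0; last exact: weight_labelings_cons.
by rewrite /label_weights /= M_gt0 /maj_fun big_nil muln0.
Qed.

Lemma labelings_nseq1 n : labelings (nseq n 0) 1 = [:: nseq n (0, 0)].
Proof. by elim: n => //= n IHn; rewrite add0n IHn. Qed.

(** * Shuffle compatibility *)

(** By induction on [d], the pairs with second component below [d] are
    determined.  At the bound [d + 1] they have known weights, which can be
    cancelled; a pair [(m, d)] adds only [m], the zero sequence being the single
    one below 1, and larger second components add nothing. *)
Lemma label_weights_inj c n (L L' : seq (nat * nat)) :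
  (forall M, 0 < M ->
     perm_eq (flatten [seq label_weights c n md M | md <- L])
             (flatten [seq label_weights c n md M | md <- L'])) ->
  perm_eq L L'.
Proof.
move=> eqW.
have split d (X : seq (nat * nat)) : perm_eq [seq t <- X | t.2 < d.+1]
    ([seq t <- X | t.2 < d] ++ [seq (m, d) | m <- [seq t.1 | t <- X & t.2 == d]]).
  rewrite -map_comp (eq_in_map _ id _).1 ?map_id; last first.
    by move=> [m d']; rewrite mem_filter /= => /andP[/eqP->].
  rewrite -(perm_filterC (fun t => t.2 < d) [seq t <- X | t.2 < d.+1]).
  rewrite -!filter_predI; apply/permP => a; congr (count a _).
  by congr (_ ++ _); apply: eq_filter => t /=; lia.
have key d (X : seq (nat * nat)) :
    perm_eq (flatten [seq label_weights c n md d.+1 | md <- X])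
      (flatten [seq label_weights c n md d.+1 | md <- [seq t <- X | t.2 < d]]
       ++ [seq t.1 | t <- X & t.2 == d]).
  have /permEl/(perm_map _)/perm_flatten/permPl<- :=
    perm_filterC (fun t => t.2 < d) X.
  rewrite map_cat flatten_cat perm_cat2l.
  apply/permP => a; congr (count a _); elim: X => //= -[m d'] X IHX.
  rewrite /= -leqNgt eqn_leq.
  case: (ltngtP d' d) => //= [lt_d|->].
    by rewrite /label_weights /= ltnNge lt_d.
  rewrite {1}/label_weights /= ltnSn subSnn labelings_nseq1 IHX /=.
  by rewrite /weight /unzip1 map_nseq sumn_nseq muln0 addn0.
have below d : perm_eq [seq t <- L | t.2 < d] [seq t <- L' | t.2 < d].
  elim: d => [|d IHd]; first by rewrite !(eq_filter (a2 := pred0)) ?filter_pred0.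
  rewrite (permPl (split d L)) (permPr (split d L')) perm_cat //.
  apply: perm_map.
  rewrite -(perm_cat2l (flatten [seq label_weights c n md d.+1
                                | md <- [seq t <- L | t.2 < d]])).
  rewrite -(permPl (key d L)) (permPl (eqW d.+1 isT)) (permPl (key d L')).
  by rewrite perm_cat2r perm_flatten // perm_map // perm_sym.
have count_below t (X : seq (nat * nat)) :
    count_mem t [seq u <- X | u.2 < t.2.+1] = count_mem t X.
  rewrite count_filter; apply: eq_count => u /=.
  by case: eqP => //= ->; rewrite ltnSn.
apply/allP => t _ /=; have /permP/(_ (pred1 t)) := below t.2.+1.
by rewrite !count_below => ->.
Qed.

Lemma maj_des_shuffles c p p' s s' :
  uniq (p ++ s) -> uniq (p' ++ s') ->
  size p = size p' -> size s = size s' ->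
  c * maj_fun p = c * maj_fun p' -> des_fun p = des_fun p' ->
  c * maj_fun s = c * maj_fun s' -> des_fun s = des_fun s' ->
  perm_eq [seq (c * maj_fun t, des_fun t) | t <- shuffles p s]
          [seq (c * maj_fun t, des_fun t) | t <- shuffles p' s'].
Proof.
move=> ups ups' szp szs majp desp majs dess.
have weights q u M : uniq (q ++ u) -> 0 < M ->
    perm_eq (flatten [seq label_weights c (size q + size u) md M
               | md <- [seq (c * maj_fun t, des_fun t) | t <- shuffles q u]])
      [seq a + b | a <- [seq c * weight z | z <- labelings q M],
                   b <- [seq c * weight z | z <- labelings u M]].
  (* The left side lists the scaled weights of all labelings of all shuffles. *)
  move=> uqu M_gt0; rewrite allpairs_mapl allpairs_mapr.
  have := perm_map (fun z => c * weight z) (labelings_shuffles M uqu).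
  rewrite map_flatten -map_comp => /permPl; rewrite -map_comp.
  have /eq_in_map-> : {in shuffles q u, map (fun z => c * weight z) \o labelings^~ M =1
      (fun t => label_weights c (size q + size u) (c * maj_fun t, des_fun t) M)}.
    move=> t; rewrite mem_shuffles // => /and3P[/perm_size tqu _ _] /=.
    by rewrite weight_labelings // tqu size_cat.
  move=> eqW; rewrite eqW map_allpairs.
  apply/permP => a; congr (count a _); apply: eq_allpairs => z z'.
  rewrite -mulnDr; congr (_ * _); rewrite /weight -sumn_cat -map_cat.
  by apply: perm_sumn; rewrite perm_map // perm_sort.
apply: (label_weights_inj (c := c) (n := size p + size s)) => M M_gt0.
rewrite (permPl (weights _ _ _ ups M_gt0)) szp szs (permPr (weights _ _ _ ups' M_gt0)).
by rewrite !weight_labelings // szp szs majp desp majs dess.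
Qed.

Theorem theorem5p1 : shuffle_compatible des /\ shuffle_compatible maj_des.
Proof.
have uniq_disjoint q u : is_permutation q -> is_permutation u ->
    disjoint_dom q u -> uniq (q ++ u).
  move=> /andP[uq _] /andP[uu _] qu; rewrite cat_uniq uq uu andbT.
  by apply/hasPn => x xu; apply/negP => /qu; rewrite xu.
split=> p p' s s' pp pp' ps ps' szp szs dps dps'.
  move=> desp dess.
  have := @maj_des_shuffles 0 p p' s s'.
  rewrite !mul0n => /(_ (uniq_disjoint _ _ pp ps dps) (uniq_disjoint _ _ pp' ps' dps')).
  move=> /(_ szp szs erefl desp erefl dess) /(perm_map snd).
  by rewrite -!map_comp.
move=> -[majp desp] [majs dess].
have := @maj_des_shuffles 1 p p' s s'.
rewrite !mul1n => /(_ (uniq_disjoint _ _ pp ps dps) (uniq_disjoint _ _ pp' ps' dps')).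
move=> /(_ szp szs majp desp majs dess).
by under eq_map do rewrite mul1n; under [X in perm_eq _ X]eq_map do rewrite mul1n.
Qed.
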